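(* Let $m\ge 1$, $n\ge 1$ and let $P(z)=A_0+A_1z+\cdots+A_{m-1}z^{m-1}+Iz^m$ be a monic matrix polynomial with $A_i\in\mathbb{C}^{n\times n}$ and $A_0$ non-singular. Denote $$M=\max_{i=0,\ldots,m-1}\|A_i\|.$$ Then each eigenvalue $\lambda$ of $P(z)$ satisfies $$\frac{\|A_0^{-1}\|^{-1}}{2(1+M)^{m-1}(Mm+1)}\le|\lambda|$$ and $$|\lambda|\le 1+\lambda_0M,$$ where $\lambda_0$ is a root of the equation $x=1-\dfrac{1}{(Mx+1)^m}$ in the interval $(0,1)$ (that is, the upper bound holds for any such root $\lambda_0\in(0,1)$).
   Context: A number $\lambda\in\mathbb{C}$ is an eigenvalue of the matrix polynomial $P(z)$ if there is a nonzero vector $x\in\mathbb{C}^n$ with $P(\lambda)x=0$. $I$ is the $n\times n$ identity matrix. $\|\cdot\|$ denotes a subordinate matrix norm, i.e. the operator norm on $\mathbb{C}^{n\times n}$ induced by an arbitrary fixed vector norm on $\mathbb{C}^n$. *)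

(* Defs.v *)
From HB Require Import structures.
From mathcomp Require Import all_boot all_order all_algebra.
From mathcomp Require Import complex.
From mathcomp Require Import classical_sets reals.

Set Implicit Arguments.
Unset Strict Implicit.
Unset Printing Implicit Defensive.

Import Order.TTheory GRing.Theory Num.Theory.

Local Open Scope ring_scope.
Local Open Scope classical_set_scope.
Local Open Scope complex_scope.

(* The canonical norm on a complex number is itself complex-valued (z |-> `|z|
   lies in R[i]); cmod is the real-valued modulus. *)
Notation cmod := ComplexField.Normc.normc.

Record vector_norm (R : realType) (n : nat) (nu : 'cV[R[i]]_n -> R) : Prop :=
  VectorNorm {
    vnorm_ge0 : forall x, 0 <= nu x;
    vnorm_eq0 : forall x, nu x = 0 -> x = 0;
    vnormZ : forall (c : R[i]) x, nu (c *: x) = cmod c * nu x;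
    vnormD : forall x y, nu (x + y) <= nu x + nu y
  }.

(* For n > 0 and nu a vector norm the set below is nonempty and, the dimension
   being finite, bounded above; hence sup does not take its default value 0. *)
Definition subordinate_norm (R : realType) (n : nat) (nu : 'cV[R[i]]_n -> R)
    (A : 'M[R[i]]_n) : R :=
  sup [set nu (A *m x) / nu x | x in [set x : 'cV[R[i]]_n | x != 0]].

(* A matrix polynomial \sum_k A_k z^k is a polynomial P with matrix
   coefficients P`_k = A_k.  Its value at the scalar lambda is the Horner value
   at the scalar matrix lambda%:M, i.e. \sum_k P`_k * lambda%:M ^+ k.
   The dimension is n.+1 because {poly _} needs a nontrivial coefficient
   ring. *)
Definition mxpoly_eigenvalue (R : realType) (n : nat)
    (P : {poly 'M[R[i]]_n.+1}) (lambda : R[i]) : Prop :=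
  exists2 x : 'cV[R[i]]_n.+1, x != 0 & P.[lambda%:M] *m x = 0.

(* Main.v *)
Require Import Defs.
From HB Require Import structures.
From mathcomp Require Import all_boot all_order all_algebra.
From mathcomp Require Import complex.
From mathcomp Require Import classical_sets reals.
From mathcomp Require Import boolp topology normedtype derive.
From mathcomp Require Import ring lra.

Set Implicit Arguments.
Unset Strict Implicit.
Unset Printing Implicit Defensive.

Import Order.TTheory GRing.Theory Num.Theory.
Import numFieldNormedType.Exports.

Local Open Scope ring_scope.
Local Open Scope classical_set_scope.
Local Open Scope complex_scope.

(** Let [x] be an eigenvector for [lambda] and put [r = |lambda|].

    Taking norms in [lambda ^ m x = - \sum_(i < m) lambda ^ i A_i x] gives the
    scalar majorant inequality [r ^ m <= M \sum_(i < m) r ^ i], from which both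
    bounds follow by summing geometric progressions.

    Upper bound: [M > 0], as [M = 0] would force [lambda0 = 0].  Multiplying the
    equation for [lambda0] by [M (M lambda0 + 1) ^ m] and dividing by
    [M lambda0] shows that [s = 1 + M lambda0] turns the majorant inequality
    into an equality ([majorant_root_of_fixpoint]).  Since
    [M \sum_(i < m) t ^ (i - m)] decreases in [t > 0], no [r > s] can satisfy
    the inequality ([majorant_le_root]).

    Lower bound: writing
    [A_0 x = - lambda (A_1 x + ... + lambda ^ (m - 1) x)] and multiplying by the
    inverse of [A_0] gives [1 <= N r B] with
    [N = ||A_0 ^-1||] and [B = M \sum_(i < m - 1) r ^ i + r ^ (m - 1)].  The
    Cauchy bound [r <= 1 + M] ([majorant_le_cauchy]) controls [B]
    ([truncated_majorant_le]).

    What remains is that [nu (A x) <= ||A|| nu x], which requires the supremum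
    defining [||A||] to be over a bounded set.  This is the equivalence of norms
    in finite dimension: seen as a real norm on R^(2n), [nu] is continuous and
    positive on the compact unit sphere of the maximum norm, hence bounded below
    there by a positive constant ([rV_norm_ge_mx_norm]). *)

(** * Equivalence of norms in finite dimension *)

Lemma dist_le_continuous (R : realType) (V : normedModType R) (f : V -> R) K :
  0 < K -> (forall v w, `|f v - f w| <= K * `|v - w|) -> continuous f.
Proof.
move=> K_gt0 f_lip v; apply/cvgrPdist_lt => e e_gt0.
apply/nbhs_normP; exists (e / K) => [|w /= vw_lt]; first exact: divr_gt0.
by rewrite (le_lt_trans (f_lip _ _))// mulrC -ltr_pdivlMr.
Qed.

Lemma entry_le_mx_norm (R : realType) k (v : 'rV[R]_k) j : `|v 0 j| <= `|v|.
Proof.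
rewrite [leRHS]/Num.norm /= mx_normrE; apply/bigmax_geP; right => /=.
by exists (0, j).
Qed.

(** The constant is the minimum of [f] on the unit sphere of the maximum norm,
    which is attained by compactness and nonzero by definiteness. *)
Lemma rV_norm_ge_mx_norm (R : realType) k (f : 'rV[R]_k -> R) :
  (forall v, 0 <= f v) -> (forall v, f v = 0 -> v = 0) ->
  (forall a v, f (a *: v) = `|a| * f v) ->
  (forall v w, f (v + w) <= f v + f w) ->
  exists2 c : R, 0 < c & forall v, c * `|v| <= f v.
Proof.
move=> f_ge0 f_eq0 fZ fD.
have f0 : f 0 = 0 by rewrite -(scale0r 0) fZ normr0 mul0r.
(* The summand 1 only makes the Lipschitz constant positive. *)
pose K := \sum_j f (delta_mx 0 j) + 1.
have K_gt0 : 0 < K by rewrite ltr_wpDl// sumr_ge0.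
have f_le v : f v <= K * `|v|.
  rewrite [v in f v]row_sum_delta.
  have /le_trans -> // : f (\sum_j v 0 j *: delta_mx 0 j)
      <= \sum_j f (v 0 j *: delta_mx 0 j).
    elim/big_ind2: _ => [|v1 a1 v2 a2 h1 h2|//]; first by rewrite f0.
    by rewrite (le_trans (fD _ _)) ?lerD.
  rewrite mulrDl mul1r ler_wpDr// mulr_suml ler_sum// => j _.
  by rewrite fZ mulrC ler_wpM2l ?entry_le_mx_norm.
have f_dist v w : `|f v - f w| <= f (v - w).
  have fN u : f (- u) = f u by rewrite -scaleN1r fZ normrN1 mul1r.
  rewrite ler_distl; apply/andP; split.
    by rewrite lerBlDr -[f (v - w)]fN opprB (le_trans _ (fD _ _))// addrC subrK.
  by rewrite (le_trans _ (fD _ _))// addrC subrK.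
have f_cont : continuous f.
  apply: (@dist_le_continuous R 'rV[R]_k f K K_gt0) => v w.
  exact: le_trans (f_dist v w) (f_le _).
pose S := [set v : 'rV[R]_k | `|v| = 1].
have S_compact : compact S.
  apply: bounded_closed_compact.
    by exists 1; split=> [|M M1 v /= ->]; [exact: num_real|exact: ltW].
  have : closed ((Num.norm : 'rV[R]_k -> R) @^-1` [set x | x = 1]).
    apply: preimage_closed; last exact: closed_eq.
    by move=> v _; exact: norm_continuous.
  by [].
have S_scale v : v != 0 -> S (`|v|^-1 *: v).
  move=> v0; rewrite /S /= normrZ normfV normr_id mulVf// normr_eq0//.
(* The sphere is empty exactly when k = 0. *)
have [S0|/set0P S_neq0] := eqVneq S set0.
  exists 1 => // v; have [->|/S_scale] := eqVneq v 0; last by rewrite S0.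
  by rewrite normr0 mulr0.
have [c Sc c_min] : exists2 c, c \in S & forall t, t \in S -> f c <= f t.
  by apply: compact_EVT_min => //; exact: continuous_subspaceT.
exists (f c).
  rewrite lt_neqAle f_ge0 andbT eq_sym; apply/eqP => /f_eq0 c0.
  by move: Sc; rewrite inE /S /= c0 normr0 => /esym/eqP; rewrite oner_eq0.
move=> v; have [->|v0] := eqVneq v 0; first by rewrite normr0 mulr0.
have /c_min : `|v|^-1 *: v \in S by rewrite inE; exact: S_scale.
by rewrite fZ normfV normr_id mulrC ler_pdivlMr ?normr_gt0.
Qed.

(** * The real-valued modulus *)

Section Cmod.
Variable R : realType.
Implicit Types z w : R[i].

Lemma cmodE z : (cmod z)%:C = `|z|.
Proof. by rewrite normc_def; case: z. Qed.

Lemma cmod_ge0 z : 0 <= cmod z.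
Proof. by case: z => a b; exact: sqrtr_ge0. Qed.

Lemma cmodX z k : cmod (z ^+ k) = cmod z ^+ k.
Proof. by apply: complexI; rewrite rmorphXn /= !cmodE normrX. Qed.

Lemma cmod_real (a : R) : cmod a%:C = `|a|.
Proof. by rewrite /= expr0n addr0 sqrtr_sqr. Qed.

Lemma cmod_le_Re_Im z : cmod z <= `|complex.Re z| + `|complex.Im z|.
Proof.
rewrite -lecR cmodE rmorphD /= -!cmod_real !cmodE [z in leLHS]complexE.
rewrite (le_trans (ler_normD _ _))// lerD2l normrM.
by rewrite -[`|'i%C|]cmodE /= expr0n expr1n add0r sqrtr1 mul1r.
Qed.

End Cmod.

(** * The subordinate norm bounds the action of a matrix *)

Section VectorNorm.
Variables (R : realType) (n : nat) (nu : 'cV[R[i]]_n -> R).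
Hypothesis nuP : vector_norm nu.
Implicit Types (x y : 'cV[R[i]]_n) (A : 'M[R[i]]_n).

Lemma vnorm0 : nu 0 = 0.
Proof.
by rewrite -(scale0r 0) (vnormZ nuP) ComplexField.Normc.normc0 mul0r.
Qed.

Lemma vnormN x : nu (- x) = nu x.
Proof.
rewrite -scaleN1r (vnormZ nuP) -[RHS]mul1r; congr (_ * _).
by apply: complexI; rewrite cmodE normrN1.
Qed.

Lemma vnorm_gt0 x : x != 0 -> 0 < nu x.
Proof.
move=> x0; rewrite lt_neqAle (vnorm_ge0 nuP) andbT eq_sym.
by apply: contra x0 => /eqP/(vnorm_eq0 nuP) ->.
Qed.

Lemma vnorm_sum I (r : seq I) (F : I -> 'cV[R[i]]_n) :
  nu (\sum_(i <- r) F i) <= \sum_(i <- r) nu (F i).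
Proof.
elim/big_ind2: _ => [|v1 a1 v2 a2 h1 h2|//]; first by rewrite vnorm0.
by rewrite (le_trans (vnormD nuP _ _)) ?lerD.
Qed.

(** A complex column is identified with the real row of its real parts followed
    by its imaginary parts, so that [nu] becomes a norm on a real space; each
    modulus is at most twice the maximum norm of that row. *)
Lemma cmod_entry_le_vnorm :
  exists2 C : R, 0 <= C & forall x j, cmod (x j 0) <= C * nu x.
Proof.
pose T (v : 'rV[R]_(n + n)) : 'cV[R[i]]_n :=
  \col_j (v 0 (lshift n j) +i* v 0 (rshift n j)).
have TD v w : T (v + w) = T v + T w.
  by apply/colP => j; rewrite !mxE; simpc.
have TZ a v : T (a *: v) = a%:C *: T v.
  by apply/colP => j; rewrite !mxE; simpc.
have T_eq0 v : T v = 0 -> v = 0.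
  move=> Tv0; apply/rowP => j; rewrite mxE -(splitK j).
  by case: (split j) => l /=; have /colP/(_ l) := Tv0; rewrite !mxE => -[].
have [|||v w|c c_gt0 c_le] := @rV_norm_ge_mx_norm _ _ (nu \o T).
- by move=> v; exact: (vnorm_ge0 nuP).
- by move=> v /(vnorm_eq0 nuP) /T_eq0.
- by move=> a v; rewrite /= TZ (vnormZ nuP) cmod_real.
- by rewrite /= TD; exact: (vnormD nuP).
exists (2 / c) => [|x j]; first by rewrite divr_ge0// ltW.
pose v : 'rV[R]_(n + n) :=
  row_mx (\row_l complex.Re (x l 0)) (\row_l complex.Im (x l 0)).
have Tv : T v = x.
  by apply/colP => l; rewrite mxE row_mxEl row_mxEr !mxE; case: (x l 0).
rewrite (le_trans (cmod_le_Re_Im _))// mulrAC ler_pdivlMr//.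
have := c_le v; rewrite /= Tv => /(ler_wpM2l (ler0n _ 2)); apply: le_trans.
rewrite mulrC mulrCA ler_pM2l// mulrDl mul1r lerD//.
  by have := entry_le_mx_norm v (lshift n j); rewrite row_mxEl mxE.
by have := entry_le_mx_norm v (rshift n j); rewrite row_mxEr mxE.
Qed.

(** The quotients [nu (A *m y) / nu y] are bounded because [A *m y] combines the
    columns of [A] with coefficients [y j 0] that [nu y] controls; so [sup] is a
    genuine upper bound. *)
Lemma vnorm_mulmx_le A x : nu (A *m x) <= subordinate_norm nu A * nu x.
Proof.
have [->|x0] := eqVneq x 0; first by rewrite mulmx0 vnorm0 mulr0.
rewrite -ler_pdivrMr ?vnorm_gt0//; apply: sup_upper_bound; last by exists x.
split; first by exists (nu (A *m x) / nu x), x.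
have [C C_ge0 C_le] := cmod_entry_le_vnorm.
exists (\sum_j C * nu (col j A)) => _ [y /= y0 <-].
rewrite ler_pdivrMr ?vnorm_gt0//.
have -> : A *m y = \sum_j y j 0 *: col j A.
  apply/colP => i; rewrite summxE !mxE; apply: eq_bigr => j _.
  by rewrite !mxE mulrC.
rewrite (le_trans (vnorm_sum _ _))// mulr_suml ler_sum// => j _.
by rewrite (vnormZ nuP) mulrAC ler_wpM2r ?(vnorm_ge0 nuP).
Qed.

End VectorNorm.

(** * The majorant inequality *)

Section Majorant.
Variables (R : realFieldType) (M r : R).

(** Multiplying by [r - 1 > 0] telescopes the sum and leaves
    [(r - 1 - M) r ^ m <= - M <= 0]. *)
Lemma majorant_le_cauchy m :
  0 <= M -> r ^+ m <= M * \sum_(i < m) r ^+ i -> r <= 1 + M.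
Proof.
move=> M_ge0 r_le; rewrite leNgt; apply/negP => r_gt.
have r_gt1 : 1 < r by lra.
have := r_le; rewrite -(ler_pM2r (_ : 0 < r - 1)) ?subr_gt0//.
rewrite -mulrA [X in _ <= M * X]mulrC -subrX1.
have : 0 < r ^+ m by rewrite exprn_gt0//; lra.
nra.
Qed.

(** If [s < r], then [r ^ i s ^ m <= s r ^ (m - 1) s ^ i] for every [i < m]:
    move [m - 1 - i] factors from [s] to [r].  Summed against [M], this turns
    [r ^ m s ^ m] into at most [s r ^ (m - 1) s ^ m], that is [r <= s].  Keeping
    one factor [s] aside avoids a strict inequality between the sums. *)
Lemma majorant_le_root m (s : R) : 0 <= M -> 0 < s ->
  s ^+ m = M * \sum_(i < m) s ^+ i ->
  r ^+ m <= M * \sum_(i < m) r ^+ i -> r <= s.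
Proof.
move=> M_ge0 s_gt0; case: m => [|k].
  by rewrite big_ord0 mulr0 expr0 => /eqP; rewrite oner_eq0.
move=> s_root r_le; rewrite leNgt; apply/negP => lt_sr.
have r_gt0 : 0 < r by exact: lt_trans lt_sr.
have : r ^+ k.+1 * s ^+ k.+1 <= s * r ^+ k * s ^+ k.+1.
  rewrite [in leRHS]s_root.
  rewrite (le_trans (ler_wpM2r (exprn_ge0 _ (ltW s_gt0)) r_le))//.
  rewrite -[leLHS]mulrA [leRHS]mulrCA ler_wpM2l// mulr_suml mulr_sumr.
  rewrite ler_sum// => i _.
  have ik : (i <= k)%N by rewrite -ltnS.
  rewrite -[in s ^+ k.+1](subnK ik) -[in r ^+ k](subnK ik).
  rewrite -addSn !exprD exprS.
  have : s ^+ (k - i) <= r ^+ (k - i).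
    by apply: lerXn2r; rewrite ?nnegrE ?ltW.
  have : 0 <= s * r ^+ i * s ^+ i by rewrite !mulr_ge0 ?exprn_ge0// ltW.
  nra.
rewrite ler_pM2r ?exprn_gt0// exprS ler_pM2r ?exprn_gt0//.
by rewrite leNgt lt_sr.
Qed.

(** With [s = 1 + M l], the hypothesis reads [l s ^ m = s ^ m - 1], and the
    geometric sum of [s] is [(s ^ m - 1) / (M l)]. *)
Lemma majorant_root_of_fixpoint m (l : R) : 0 < M * l ->
  l = 1 - 1 / (M * l + 1) ^+ m ->
  (1 + M * l) ^+ m = M * \sum_(i < m) (1 + M * l) ^+ i.
Proof.
move=> Ml_gt0 l_fix; set s := 1 + M * l.
have s_gt0 : 0 < s by rewrite /s; lra.
have sX_neq0 : s ^+ m != 0 by rewrite expf_neq0// gt_eqF.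
apply: (mulfI (_ : M * l != 0)); first by rewrite gt_eqF.
have {1}-> : M * l * (M * \sum_(i < m) s ^+ i) = M * (s ^+ m - 1).
  by rewrite subrX1 mulrCA; congr (_ * (_ * _)); rewrite /s; ring.
rewrite -mulrA; congr (_ * _).
move: l_fix; rewrite (addrC (M * l) 1) -/s => /(congr1 ( *%R^~ (s ^+ m))) /= ->.
by rewrite mulrBl divfK// mul1r.
Qed.

(** Each of the [k + 1] powers of [r] that occur is at most [(1 + M) ^ k]. *)
Lemma truncated_majorant_le k : 0 <= M -> 0 <= r -> r <= 1 + M ->
  M * (\sum_(i < k) r ^+ i) + r ^+ k <= (1 + M) ^+ k * (M * k.+1%:R + 1).
Proof.
move=> M_ge0 r_ge0 r_le.
have le_pow i : (i <= k)%N -> r ^+ i <= (1 + M) ^+ k.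
  move=> ik; rewrite (@le_trans _ _ ((1 + M) ^+ i))//.
    by apply: lerXn2r; rewrite ?nnegrE; lra.
  by apply: ler_weXn2l => //; lra.
have sum_le : \sum_(i < k) r ^+ i <= (1 + M) ^+ k * k%:R.
  rewrite mulr_natr -[k in _ *+ k]card_ord -sumr_const ler_sum// => i _.
  exact/le_pow/ltnW.
have := le_pow k (leqnn k).
have := ler_wpM2l M_ge0 sum_le.
have : 0 <= (1 + M) ^+ k by rewrite exprn_ge0//; lra.
rewrite -natr1; nra.
Qed.

End Majorant.

(** * Bounds on the eigenvalues of a monic matrix polynomial *)

Lemma mxpoly_mulmxE (R : comNzRingType) n (P : {poly 'M[R]_n.+1})
    (lambda : R) (x : 'cV[R]_n.+1) :
  P.[lambda%:M] *m x = \sum_(i < size P) lambda ^+ i *: (P`_i *m x).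
Proof.
rewrite horner_coef mulmx_suml; apply: eq_bigr => i _.
rewrite -rmorphXn /= -mulmxE -mulmxA mul_scalar_mx.
by rewrite -scalemxAr.
Qed.

Theorem theorem3p14 (R : realType) (m n : nat) (nu : 'cV[R[i]]_n.+1 -> R)
    (P : {poly 'M[R[i]]_n.+1}) (M : R) :
  (0 < m)%N ->
  vector_norm nu ->
  P \is monic -> size P = m.+1 ->
  P`_0 \in unitmx ->
  M = \big[Num.max/0]_(i < m) subordinate_norm nu P`_i ->
  forall lambda : R[i], mxpoly_eigenvalue P lambda ->
    (subordinate_norm nu (invmx P`_0))^-1
      / (2 * (1 + M) ^+ (m - 1) * (M * m%:R + 1)) <= cmod lambda
    /\ (forall lambda0 : R, 0 < lambda0 < 1 ->
          lambda0 = 1 - 1 / (M * lambda0 + 1) ^+ m ->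
          cmod lambda <= 1 + lambda0 * M).
Proof.
case: m => // k _ nuP /monicP; rewrite /lead_coef => P_lead szP P0_unit defM.
move=> lambda [x x0 Px].
rewrite szP /= in P_lead.
have M_ge0 : 0 <= M by rewrite defM; exact: bigmax_ge_id.
have coef_le i y : (i < k.+1)%N -> nu (P`_i *m y) <= M * nu y.
  move=> ik; rewrite (le_trans (vnorm_mulmx_le nuP _ _))//.
  rewrite ler_wpM2r ?(vnorm_ge0 nuP)// defM.
  pose F (i : 'I_k.+1) := subordinate_norm nu P`_i.
  exact: (le_bigmax _ F (Ordinal ik)).
set r := cmod lambda; have r_ge0 : 0 <= r := cmod_ge0 lambda.
have nux_gt0 := vnorm_gt0 nuP x0.
have term_le i : (i < k.+1)%N ->
    nu (lambda ^+ i *: (P`_i *m x)) <= r ^+ i * (M * nu x).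
  by move=> ik; rewrite (vnormZ nuP) cmodX ler_wpM2l ?exprn_ge0 ?coef_le.
move: Px; rewrite mxpoly_mulmxE szP => Px.
have r_le : r ^+ k.+1 <= M * \sum_(i < k.+1) r ^+ i.
  move: Px; rewrite big_ord_recr /= P_lead mul1mx => /eqP.
  rewrite addrC addr_eq0 => /eqP/(congr1 nu).
  rewrite (vnormN nuP) (vnormZ nuP) cmodX -(ler_pM2r nux_gt0) => ->.
  rewrite (le_trans (vnorm_sum nuP _ _))// mulrAC mulr_sumr ler_sum// => i _.
  by rewrite mulrC term_le.
have r_cauchy := majorant_le_cauchy M_ge0 r_le.
split; last first.
  move=> l /andP[l_gt0 _] l_fix; rewrite mulrC.
  have [M0|M_neq0] := eqVneq M 0.
    by move: l_gt0; rewrite l_fix M0 mul0r add0r expr1n divr1 subrr ltxx.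
  have Ml_gt0 : 0 < M * l by rewrite mulr_gt0// lt_neqAle eq_sym M_neq0.
  have s_root := majorant_root_of_fixpoint Ml_gt0 l_fix.
  by apply: (majorant_le_root M_ge0 _ s_root r_le); rewrite addr_gt0.
set N := subordinate_norm nu _; rewrite subn1 /=.
set Q := _ * (_ + 1).
pose B := M * (\sum_(i < k) r ^+ i) + r ^+ k.
have P0x_le : nu (P`_0 *m x) <= r * B * nu x.
  move: Px; rewrite big_ord_recl expr0 scale1r => /eqP.
  rewrite addr_eq0 => /eqP ->; rewrite (vnormN nuP).
  rewrite big_ord_recr /= P_lead mul1mx /B !(mulrDr, mulrDl).
  rewrite (le_trans (vnormD nuP _ _))// lerD//; last first.
    by rewrite (vnormZ nuP) cmodX exprS.
  rewrite (le_trans (vnorm_sum nuP _ _))// -!mulrA mulr_suml !mulr_sumr.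
  rewrite ler_sum// => i _; rewrite /bump /= add1n.
  by rewrite (le_trans (term_le _ _)) ?ltnS// exprS -!mulrA (mulrCA M).
have M1_gt0 : 0 < 1 + M by rewrite ltr_wpDr.
have Q_gt0 : 0 < Q.
  by rewrite mulr_gt0 ?(mulr_gt0 (ltr0n _ 2)) ?exprn_gt0// ltr_wpDl ?mulr_ge0.
have B_le : B <= Q.
  rewrite (le_trans (truncated_majorant_le k M_ge0 r_ge0 r_cauchy))//.
  rewrite /Q -[leRHS]mulrA ler_peMl ?ler1n// mulr_ge0 ?exprn_ge0 ?addr_ge0//.
  by rewrite mulr_ge0.
have N_ge0 : 0 <= N.
  rewrite -(pmulr_lge0 _ nux_gt0) (le_trans _ (vnorm_mulmx_le nuP _ _))//.
  exact: (vnorm_ge0 nuP).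
have N_le : 1 <= N * (r * Q).
  rewrite -(ler_pM2r nux_gt0) mul1r.
  have {1}-> : x = invmx P`_0 *m (P`_0 *m x) by rewrite mulKmx.
  rewrite (le_trans (vnorm_mulmx_le nuP _ _))// -mulrA ler_wpM2l//.
  by rewrite (le_trans P0x_le)// ler_wpM2r ?ler_wpM2l// ltW.
have N_gt0 : 0 < N.
  rewrite lt_neqAle N_ge0 andbT; apply: contraTneq N_le => <-.
  by rewrite mul0r ler10.
by rewrite ler_pdivrMr// -[N^-1]mulr1 mulrC ler_pdivrMr// mulrC.
Qed.
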